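(* Let $k$ be an algebraically closed field and let $R$ be a self-injective Nakayama $k$-algebra. Then $$E_R^{\mathrm{AUS}}\cong E_R.$$
   Context: A self-injective Nakayama algebra is here an algebra of the form $R=kC_n/J^m$, where $n,m\ge1$, $C_n$ is the oriented cycle with $n$ vertices and $J\subseteq kC_n$ is the two-sided ideal generated by all arrows. Such an algebra has finite representation type. Modules are finitely generated left modules. $\mathrm{sub}(R):=\operatorname{add}\{U\mid U\subseteq R^{\oplus n}\}$ ($\operatorname{add}$ = closure under isomorphisms, finite direct sums and direct summands), $\mathrm{SUB}(R)$ is the direct sum of all indecomposables in $\mathrm{sub}(R)$ up to isomorphism, and $E_R:=\operatorname{End}_R(\mathrm{SUB}(R))$. $\mathrm{AUS}$ is the direct sum of all indecomposable $R$-modules up to isomorphism, and the Auslander algebra is $E_R^{\mathrm{AUS}}:=\operatorname{End}_R(\mathrm{AUS})$. *)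

(* Defs.v *)
From HB Require Import structures.
From mathcomp Require Import all_boot all_order all_algebra.
From mathcomp Require Import finmap monalg boolp.

Set Implicit Arguments.
Unset Strict Implicit.
Unset Printing Implicit Defensive.

Import GRing.Theory.
Local Open Scope ring_scope.

Record quiver := Quiver {
  vertex : finType;
  arrow : finType;
  src : arrow -> vertex;
  tgt : arrow -> vertex;
  quiver_neq0 : (0 < #|vertex|)%N
}.

(* [walk v s w]: the arrows of [s], traversed from left to right, lead from
   [v] to [w]. *)
Fixpoint walk (Q : quiver) (v : vertex Q) (s : seq (arrow Q)) (w : vertex Q) :=
  if s is a :: s' then (src a == v) && walk (tgt a) s' w else v == w.

Record qpath (Q : quiver) := QPath {
  qpath_val : vertex Q * seq (arrow Q) * vertex Q;
  _ : walk qpath_val.1.1 qpath_val.1.2 qpath_val.2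
}.

HB.instance Definition _ (Q : quiver) := [isSub for @qpath_val Q].
HB.instance Definition _ (Q : quiver) := [Countable of qpath Q by <:].

Section Paths.
Variable Q : quiver.
Implicit Types (v w : vertex Q) (p q r : qpath Q).

Definition psrc p := (val p).1.1.
Definition parr p := (val p).1.2.
Definition ptgt p := (val p).2.

Lemma parrP p : walk (psrc p) (parr p) (ptgt p).
Proof. by case: p. Qed.

Lemma qpath_inj p q :
  psrc p = psrc q -> parr p = parr q -> ptgt p = ptgt q -> p = q.
Proof.
case: p q => [[[v s] w] Hp] [[[v' s'] w'] Hq]; rewrite /psrc /parr /ptgt /=.
by move=> e1 e2 e3; apply/val_inj; rewrite /= e1 e2 e3.
Qed.

Definition vpath v : qpath Q := @QPath Q (v, [::], v) (eqxx v).

Lemma apath_subproof (a : arrow Q) : walk (src a) [:: a] (tgt a).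
Proof. by rewrite /= !eqxx. Qed.

Definition apath (a : arrow Q) : qpath Q :=
  @QPath Q (src a, [:: a], tgt a) (apath_subproof a).

Lemma walk_cat v s w t x : walk v s w -> walk w t x -> walk v (s ++ t) x.
Proof.
elim: s v => [|a s IHs] v /= => [/eqP-> //|/andP[-> Hs] Ht].
exact: IHs.
Qed.

Lemma pcat_subproof p q (e : ptgt p == psrc q) :
  walk (psrc p) (parr p ++ parr q) (ptgt q).
Proof. by apply: (walk_cat (parrP p)); rewrite (eqP e) parrP. Qed.

Definition pcat p q (e : ptgt p == psrc q) : qpath Q :=
  @QPath Q (psrc p, parr p ++ parr q, ptgt q) (pcat_subproof e).

(* The composite path "[p] after [q]", when it is defined. *)
Definition pcomp p q : option (qpath Q) :=
  if boolP (ptgt q == psrc p) is AltTrue e then Some (pcat e) else None.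

Variant pcomp_spec p q : option (qpath Q) -> Type :=
| PcompSome r of ptgt q = psrc p & psrc r = psrc q & ptgt r = ptgt p
    & parr r = parr q ++ parr p : pcomp_spec p q (Some r)
| PcompNone of ptgt q <> psrc p : pcomp_spec p q None.

Lemma pcompP p q : pcomp_spec p q (pcomp p q).
Proof.
rewrite /pcomp; case: {-}_ / boolP => e; first by constructor=> //; apply/eqP.
by constructor; apply/eqP.
Qed.

Lemma pcompA p q r :
  obind (pcomp p) (pcomp q r) = obind (fun s => pcomp s r) (pcomp p q).
Proof.
case: (pcompP q r) => [x e1 e2 e3 e4|ne]; case: (pcompP p q) => [y f1 f2 f3 f4|nf] //=.
- case: (pcompP p x) => [z g1 g2 g3 g4|]; last by rewrite e3.
  case: (pcompP y r) => [t h1 h2 h3 h4|]; last by rewrite f2.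
  congr Some; apply: qpath_inj; rewrite ?g2 ?g3 ?g4 ?h2 ?h3 ?h4 //.
  by rewrite e4 f4 catA.
- by case: (pcompP p x) => // z; rewrite e3.
- by case: (pcompP y r) => // z; rewrite f2.
Qed.

Lemma pcomp1p v p : pcomp (vpath v) p = if v == ptgt p then Some p else None.
Proof.
case: (pcompP (vpath v) p) => [r e1 e2 e3 e4|]; last first.
  by rewrite /psrc /= => /eqP; rewrite eq_sym => /negPf->.
rewrite e1 eqxx; congr Some; apply: qpath_inj => //; last by rewrite e3 e1.
by rewrite e4 cats0.
Qed.

Lemma pcompp1 v p : pcomp p (vpath v) = if v == psrc p then Some p else None.
Proof.
case: (pcompP p (vpath v)) => [r e1 e2 e3 e4|]; last first.
  by rewrite /ptgt /= => /eqP/negPf->.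
rewrite -e1 eqxx; congr Some; apply: qpath_inj => //.
by rewrite e2 -e1.
Qed.

End Paths.

(* Free module with basis the paths of Q. *)
Definition path_algebra (k : fieldType) (Q : quiver) := {malg k[qpath Q]}.

HB.instance Definition _ (k : fieldType) (Q : quiver) :=
  GRing.Lmodule.on (path_algebra k Q).

HB.lock Definition of_path (k : fieldType) (Q : quiver) (p : qpath Q) :
  path_algebra k Q := << 1 *g p >>.

Definition of_opath (k : fieldType) (Q : quiver) (o : option (qpath Q)) :
  path_algebra k Q := if o is Some p then of_path k p else 0.

Definition pa_one (k : fieldType) (Q : quiver) : path_algebra k Q :=
  \sum_(x : vertex Q) of_path k (vpath x).

(* Bilinear extension of the composition of paths; the product of two paths
   that cannot be composed is 0.  Paths are composed like functions ([p * q]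
   is "[q], then [p]"), so that left modules are representations of Q. *)
HB.lock Definition pa_mul (k : fieldType) (Q : quiver)
    (u v : path_algebra k Q) : path_algebra k Q :=
  \sum_(p <- msupp u) \sum_(q <- msupp v)
    (u@_p * v@_q) *: of_opath k (pcomp p q).

Section PathAlgebra.
Variables (k : fieldType) (Q : quiver).
Local Notation A := (path_algebra k Q).
Local Notation of_path := (@of_path k Q).
Local Notation of_opath := (@of_opath k Q).
Local Notation pa_one := (pa_one k Q).
Local Notation pa_mul := (@pa_mul k Q).
Implicit Types (u v w : A) (p q r : qpath Q).

Lemma mcoeff_of_path p q : (of_path p)@_q = (p == q)%:R.
Proof. by rewrite unlock mcoeffU. Qed.

Definition mlin (V : lmodType k) (h : qpath Q -> V) u : V :=
  \sum_(p <- msupp u) u@_p *: h p.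

Lemma mlinEw (V : lmodType k) (h : qpath Q -> V) u (d : {fset qpath Q}) :
  fsubset (msupp u) d -> mlin h u = \sum_(p <- d) u@_p *: h p.
Proof.
move=> le; rewrite /mlin; apply/big_fset_incl => // p _ /mcoeff_outdom ->.
by rewrite scale0r.
Qed.

Lemma mlin_linear (V : lmodType k) (h : qpath Q -> V) : linear (mlin h).
Proof.
move=> c u v; pose d := fsetU (msupp (c *: u + v)) (fsetU (msupp u) (msupp v)).
have su : fsubset (msupp u) d.
  by apply: fsubset_trans (fsubsetUr _ _); exact: fsubsetUl.
have sv : fsubset (msupp v) d.
  by apply: fsubset_trans (fsubsetUr _ _); exact: fsubsetUr.
rewrite (mlinEw _ su) (mlinEw _ sv) (mlinEw _ (fsubsetUl _ _ : fsubset _ d)).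
rewrite scaler_sumr -big_split; apply: eq_bigr => p _ /=.
by rewrite mcoeffD mcoeffZ scalerDl scalerA.
Qed.

HB.instance Definition _ (V : lmodType k) (h : qpath Q -> V) :=
  GRing.isLinear.Build k A V *:%R (mlin h) (mlin_linear h).

Lemma mlinU (V : lmodType k) (h : qpath Q -> V) p : mlin h (of_path p) = h p.
Proof.
rewrite unlock (mlinEw _ (msuppU_le : fsubset _ [fset p]%fset)) big_seq_fset1.
by rewrite mcoeffUU scale1r.
Qed.

Lemma of_pathE u : u = \sum_(p <- msupp u) u@_p *: of_path p.
Proof.
rewrite [LHS]monalgE; apply: eq_bigr => p _.
by apply/malgP => q; rewrite mcoeffU mcoeffZ mcoeff_of_path mulr_natr.
Qed.

Lemma pa_ext (V : lmodType k) (f g : {linear A -> V}) :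
  (forall p, f (of_path p) = g (of_path p)) -> f =1 g.
Proof.
move=> fg u; rewrite (of_pathE u) !linear_sum; apply: eq_bigr => p _.
by rewrite !linearZ /= fg.
Qed.

Lemma pa_mulEl u v :
  pa_mul u v = mlin (fun p => mlin (fun q => of_opath (pcomp p q)) v) u.
Proof.
rewrite unlock; apply: eq_bigr => p _; rewrite scaler_sumr; apply: eq_bigr => q _.
by rewrite scalerA.
Qed.

Lemma pa_mulEr u v :
  pa_mul u v = mlin (fun q => mlin (fun p => of_opath (pcomp p q)) u) v.
Proof.
rewrite unlock exchange_big; apply: eq_bigr => q _ /=.
rewrite scaler_sumr; apply: eq_bigr => p _.
by rewrite scalerA mulrC.
Qed.

Lemma pa_mul_linl v : linear (pa_mul^~ v).
Proof. by move=> c x y /=; rewrite !pa_mulEl linearP. Qed.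

Lemma pa_mul_linr u : linear (pa_mul u).
Proof. by move=> c x y /=; rewrite !pa_mulEr linearP. Qed.

HB.instance Definition _ u :=
  GRing.isLinear.Build k A A *:%R (pa_mul u) (pa_mul_linr u).

Definition pa_mulr v u := pa_mul u v.

HB.instance Definition _ v :=
  GRing.isLinear.Build k A A *:%R (pa_mulr v) (pa_mul_linl v).

Lemma pa_mulUU p q : pa_mul (of_path p) (of_path q) = of_opath (pcomp p q).
Proof. by rewrite pa_mulEl mlinU mlinU. Qed.

Lemma pa_mulUo p o :
  pa_mul (of_path p) (of_opath o) = of_opath (obind (pcomp p) o).
Proof.
case: o => [q|] /=; first exact: pa_mulUU.
exact: (linear0 (pa_mul (of_path p))).
Qed.

Lemma pa_muloU o q :
  pa_mul (of_opath o) (of_path q) = of_opath (obind (fun p => pcomp p q) o).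
Proof.
case: o => [p|] /=; first exact: pa_mulUU.
exact: (linear0 (pa_mulr (of_path q))).
Qed.

Lemma pa_mulA : associative pa_mul.
Proof.
move=> u v w.
apply: (pa_ext (f := pa_mulr (pa_mul v w)) (g := pa_mulr w \o pa_mulr v)) => p.
rewrite /= /pa_mulr.
apply: (pa_ext (f := pa_mul (of_path p) \o pa_mulr w)
               (g := pa_mulr w \o pa_mul (of_path p))) => q.
rewrite /= /pa_mulr.
apply: (pa_ext (f := pa_mul (of_path p) \o pa_mul (of_path q))
               (g := pa_mul (pa_mul (of_path p) (of_path q)))) => r.
by rewrite /= pa_mulUU pa_mulUU pa_mulUo pa_muloU pcompA.
Qed.

Lemma pa_mul1 : left_id pa_one pa_mul.
Proof.
move=> u; apply: (pa_ext (f := pa_mul pa_one) (g := idfun)) => p /=.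
rewrite -[LHS]/(pa_mulr _ _) linear_sum (bigD1 (ptgt p)) //= big1 => [|x xp].
  by rewrite addr0 /pa_mulr pa_mulUU pcomp1p eqxx.
by rewrite /pa_mulr pa_mulUU pcomp1p (negPf xp).
Qed.

Lemma pa_1mul : right_id pa_one pa_mul.
Proof.
move=> u; apply: (pa_ext (f := pa_mulr pa_one) (g := idfun)) => p /=.
rewrite /pa_mulr linear_sum (bigD1 (psrc p)) //= big1 => [|x xp].
  by rewrite addr0 pa_mulUU pcompp1 eqxx.
by rewrite pa_mulUU pcompp1 (negPf xp).
Qed.

Lemma pa_mulDl : left_distributive pa_mul +%R.
Proof. by move=> x y z; rewrite -[LHS]/(pa_mulr _ _) linearD. Qed.

Lemma pa_mulDr : right_distributive pa_mul +%R.
Proof. by move=> x y z; rewrite linearD. Qed.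

Lemma mcoeff_pa_one x : pa_one@_(vpath x) = 1.
Proof.
rewrite raddf_sum (bigD1 x) //= big1 => [|y yx]; rewrite mcoeff_of_path ?eqxx ?addr0 //.
by rewrite -[_ == _]/((_, _, _) == (_, _, _)) !xpair_eqE (negPf yx).
Qed.

Lemma pa_one_neq0 : pa_one != 0.
Proof.
have /card_gt0P[x _] := quiver_neq0 Q.
apply/eqP => /(congr1 (mcoeff (vpath x))) /eqP.
by rewrite mcoeff_pa_one mcoeff0 oner_eq0.
Qed.

HB.instance Definition _ := GRing.Zmodule_isNzRing.Build A
  pa_mulA pa_mul1 pa_1mul pa_mulDl pa_mulDr pa_one_neq0.

Lemma pa_scaleAl (c : k) u v : c *: (u * v) = (c *: u) * v.
Proof. by rewrite -[RHS]/(pa_mulr _ _) linearZ. Qed.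

HB.instance Definition _ := GRing.Lmodule_isLalgebra.Build k A pa_scaleAl.

Lemma pa_scaleAr (c : k) u v : c *: (u * v) = u * (c *: v).
Proof. by rewrite -[RHS]/(pa_mul _ _) linearZ. Qed.

HB.instance Definition _ := GRing.Lalgebra_isAlgebra.Build k A pa_scaleAr.

End PathAlgebra.

Definition ideal_closed (A : nzRingType) (I : A -> Prop) : Prop :=
  [/\ I 0, forall x y, I x -> I y -> I (x + y)
    & forall a x b, I x -> I (a * x * b)].

Record ideal (A : nzRingType) := Ideal {
  ideal_pred :> A -> Prop;
  idealP : ideal_closed ideal_pred
}.

Section Ideals.
Variable A : nzRingType.
Implicit Types (I J : ideal A).

Lemma ideal0 I : I 0. Proof. by case: (idealP I). Qed.
Lemma idealD I x y : I x -> I y -> I (x + y).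
Proof. by case: (idealP I) => _ + _; apply. Qed.
Lemma idealM I a x b : I x -> I (a * x * b).
Proof. by case: (idealP I) => _ _; apply. Qed.
Lemma idealMl I a x : I x -> I (a * x).
Proof. by move=> Ix; rewrite -[_ * _]mulr1; apply: idealM. Qed.
Lemma idealMr I x b : I x -> I (x * b).
Proof. by move=> Ix; rewrite -[x]mul1r; apply: idealM. Qed.
Lemma idealN I x : I x -> I (- x).
Proof. by move=> Ix; rewrite -mulN1r; apply: idealMl. Qed.
Lemma idealB I x y : I x -> I y -> I (x - y).
Proof. by move=> Ix /idealN; apply: idealD. Qed.

Lemma ideal_full_subproof : ideal_closed (fun _ : A => True).
Proof. by []. Qed.
Definition ideal_full : ideal A := Ideal ideal_full_subproof.

Definition ideal_gen_pred (S : A -> Prop) (x : A) : Prop :=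
  forall I : ideal A, (forall s, S s -> I s) -> I x.

Lemma ideal_gen_subproof (S : A -> Prop) : ideal_closed (ideal_gen_pred S).
Proof.
split=> [I _|x y Ix Iy I SI|a x b Ix I SI]; first exact: ideal0.
- by apply: idealD; [apply: Ix | apply: Iy].
- by apply: idealM; apply: Ix.
Qed.
Definition ideal_gen (S : A -> Prop) : ideal A := Ideal (ideal_gen_subproof S).

Definition ideal_mul I J : ideal A :=
  ideal_gen (fun z => exists x y, [/\ I x, J y & z = x * y]).

Definition ideal_pow I (m : nat) : ideal A := iter m (ideal_mul I) ideal_full.

Lemma ideal_pow_sub I m x : ideal_pow I m.+1 x -> I x.
Proof. by apply => _ [a [b [Ia _ ->]]]; apply: idealMr. Qed.

End Ideals.

Section Quotient.
Variables (A : nzRingType) (I : ideal A).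
Local Open Scope quotient_scope.

Definition ideal_rel (x y : A) : bool := `[< I (x - y) >].

Lemma ideal_rel_equiv : equiv_class_of ideal_rel.
Proof.
split=> [x|x y|y x z].
- by apply/asboolP; rewrite subrr; apply: ideal0.
- by apply/asboolP/asboolP => /idealN; rewrite opprB.
- move=> /asboolP xy /asboolP yz; apply/asboolP.
  by rewrite -(subrKA y); apply: idealD.
Qed.

Canonical ideal_equiv := EquivRelPack ideal_rel_equiv.
Canonical ideal_encModRel := defaultEncModRel ideal_rel.

Definition quot_ring := {eq_quot ideal_rel}.
HB.instance Definition _ := Choice.on quot_ring.

Definition qpi (x : A) : quot_ring := \pi_{eq_quot ideal_rel} x.
Definition qrepr (x : quot_ring) : A := repr (x : {eq_quot ideal_rel}).

Lemma qreprK x : qpi (qrepr x) = x.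
Proof. exact: reprK. Qed.

Lemma qpiP x y : qpi x = qpi y <-> I (x - y).
Proof.
split=> [/eqquotP/asboolP //|xy]; apply/eqquotP; exact/asboolP.
Qed.

Lemma qrepr_pi x : I (qrepr (qpi x) - x).
Proof. by apply/qpiP; rewrite qreprK. Qed.

Lemma qpi_ind (P : quot_ring -> Prop) : (forall x, P (qpi x)) -> forall x, P x.
Proof. by move=> Px x; rewrite -[x]qreprK. Qed.

Definition q_add x y : quot_ring := qpi (qrepr x + qrepr y).
Definition q_opp x : quot_ring := qpi (- qrepr x).
Definition q_mul x y : quot_ring := qpi (qrepr x * qrepr y).

Lemma q_addE x y : q_add (qpi x) (qpi y) = qpi (x + y).
Proof. by apply/qpiP; rewrite opprD addrACA; apply: idealD; apply: qrepr_pi. Qed.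

Lemma q_oppE x : q_opp (qpi x) = qpi (- x).
Proof. by apply/qpiP; rewrite -opprD; apply/idealN/qrepr_pi. Qed.

Lemma q_mulE x y : q_mul (qpi x) (qpi y) = qpi (x * y).
Proof.
apply/qpiP; set x' := qrepr _; set y' := qrepr _.
have -> : x' * y' - x * y = (x' - x) * y' + x * (y' - y).
  by rewrite mulrBl mulrBr addrA subrK.
by apply: idealD; [apply: idealMr | apply: idealMl]; apply: qrepr_pi.
Qed.

Lemma q_addA : associative q_add.
Proof. by do 3!elim/qpi_ind=> ?; rewrite !q_addE addrA. Qed.
Lemma q_addC : commutative q_add.
Proof. by do 2!elim/qpi_ind=> ?; rewrite !q_addE addrC. Qed.
Lemma q_add0 : left_id (qpi 0) q_add.
Proof. by elim/qpi_ind=> ?; rewrite q_addE add0r. Qed.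
Lemma q_addN : left_inverse (qpi 0) q_opp q_add.
Proof. by elim/qpi_ind=> ?; rewrite q_oppE q_addE addNr. Qed.
HB.instance Definition _ :=
  GRing.isZmodule.Build quot_ring q_addA q_addC q_add0 q_addN.

Lemma q_mulA : associative q_mul.
Proof. by do 3!elim/qpi_ind=> ?; rewrite !q_mulE mulrA. Qed.
Lemma q_mul1 : left_id (qpi 1) q_mul.
Proof. by elim/qpi_ind=> ?; rewrite q_mulE mul1r. Qed.
Lemma q_1mul : right_id (qpi 1) q_mul.
Proof. by elim/qpi_ind=> ?; rewrite q_mulE mulr1. Qed.
Lemma q_mulDl : left_distributive q_mul +%R.
Proof.
by do 3!elim/qpi_ind=> ?; rewrite /+%R /= !(q_mulE, q_addE) mulrDl.
Qed.
Lemma q_mulDr : right_distributive q_mul +%R.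
Proof.
by do 3!elim/qpi_ind=> ?; rewrite /+%R /= !(q_mulE, q_addE) mulrDr.
Qed.
HB.instance Definition _ := GRing.Zmodule_isPzRing.Build quot_ring
  q_mulA q_mul1 q_1mul q_mulDl q_mulDr.

Lemma qpiD x y : qpi (x + y) = qpi x + qpi y.
Proof. by rewrite -[RHS]/(q_add _ _) q_addE. Qed.
Lemma qpiM x y : qpi (x * y) = qpi x * qpi y.
Proof. by rewrite -[RHS]/(q_mul _ _) q_mulE. Qed.

End Quotient.

Section QuotientAlgebra.
Variables (k : fieldType) (A : algType k) (I : ideal A).
Local Notation quot_ring := (quot_ring I).
Local Notation qpi := (@qpi A I).

Definition q_scale (c : k) (x : quot_ring) : quot_ring := qpi (c *: qrepr x).

Lemma q_scaleE c x : q_scale c (qpi x) = qpi (c *: x).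
Proof.
apply/qpiP; rewrite -scalerBr -mulr_algl.
by apply/idealMl/qrepr_pi.
Qed.

Lemma q_scaleA a b x : q_scale a (q_scale b x) = q_scale (a * b) x.
Proof. by elim/qpi_ind: x => x; rewrite !q_scaleE scalerA. Qed.
Lemma q_scale1 : left_id 1 q_scale.
Proof. by elim/qpi_ind=> x; rewrite q_scaleE scale1r. Qed.
Lemma q_scaleDr : right_distributive q_scale +%R.
Proof.
by move=> c; do 2!elim/qpi_ind=> ?; rewrite -qpiD !q_scaleE scalerDr qpiD.
Qed.
Lemma q_scaleDl x : {morph q_scale^~ x : a b / a + b}.
Proof.
by move=> a b; elim/qpi_ind: x => x; rewrite !q_scaleE scalerDl qpiD.
Qed.
HB.instance Definition _ := GRing.Zmodule_isLmodule.Build k quot_ring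
  q_scaleA q_scale1 q_scaleDr q_scaleDl.

Lemma qpiZ c x : qpi (c *: x) = c *: qpi x.
Proof. by rewrite -[RHS]/(q_scale _ _) q_scaleE. Qed.

Lemma q_scaleAl (c : k) (x y : quot_ring) : c *: (x * y) = (c *: x) * y.
Proof.
by elim/qpi_ind: x => x; elim/qpi_ind: y => y; rewrite -qpiM -!qpiZ -qpiM scalerAl.
Qed.
Lemma q_scaleAr (c : k) (x y : quot_ring) : c *: (x * y) = x * (c *: y).
Proof.
by elim/qpi_ind: x => x; elim/qpi_ind: y => y; rewrite -qpiM -!qpiZ -qpiM scalerAr.
Qed.

End QuotientAlgebra.

(* The oriented cycle with n.+1 vertices: the arrow [i] goes from the vertex
   [i] to the vertex [i + 1 mod n.+1]. *)
Lemma cycle_neq0 n : (0 < #|'I_n.+1|)%N.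
Proof. by rewrite card_ord. Qed.

Definition cycle_quiver (n : nat) : quiver :=
  @Quiver 'I_n.+1 'I_n.+1 id (fun i => ordS i) (cycle_neq0 n).

Definition arrow_ideal (k : fieldType) (Q : quiver) : ideal (path_algebra k Q) :=
  ideal_gen (fun x => exists a : arrow Q, x = of_path k (apath a)).

Lemma arrow_ideal_coeff (k : fieldType) (Q : quiver) x (v : vertex Q) :
  arrow_ideal k Q x -> x@_(vpath v) = 0.
Proof.
have cE (u : path_algebra k Q) :
    u@_(vpath v) = \sum_(p <- msupp u) u@_p * (p == vpath v)%:R.
  rewrite {1}(of_pathE u) raddf_sum; apply: eq_bigr => p _.
  by rewrite /= mcoeffZ mcoeff_of_path.
have mulE (a b : path_algebra k Q) :
    (a * b)@_(vpath v) = a@_(vpath v) * b@_(vpath v).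
  rewrite -[a * b]/(pa_mul a b) pa_mul.unlock raddf_sum (cE a) mulr_suml.
  apply: eq_bigr => p _; rewrite raddf_sum (cE b) mulr_sumr.
  apply: eq_bigr => q _; rewrite /= mcoeffZ mulrACA; congr (_ * _).
  rewrite -natrM mulnb.
  case: pcompP => [r e1 e2 e3 e4|ne] /=.
    rewrite mcoeff_of_path; congr (_%:R); congr nat_of_bool.
    apply/eqP/andP => [e|[/eqP ep /eqP eq]].
      have := e4; rewrite e => /(congr1 size) /=; rewrite size_cat => /esym/eqP.
      rewrite addn_eq0 !size_eq0 => /andP[/eqP q0 /eqP p0].
      have := parrP p; have := parrP q; rewrite p0 q0 /= => /eqP qe /eqP pe.
      move: e2 e3; rewrite e -[psrc _]/v -[ptgt _]/v => e2 e3.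
      split; apply/eqP; apply: qpath_inj; rewrite -?[psrc (vpath _)]/v -?[ptgt (vpath _)]/v //; congruence.
    by apply: qpath_inj; rewrite ?e2 ?e3 ?e4 ?ep ?eq.
  rewrite mcoeff0; case: eqP => //= ep; case: eqP => //= eq.
  by case: ne; rewrite ep eq.
have cl : ideal_closed (fun x : path_algebra k Q => x@_(vpath v) = 0).
  split=> [|a b /= a0 b0|a b c /= b0]; first exact: mcoeff0.
    by rewrite mcoeffD a0 b0 addr0.
  by rewrite !mulE b0 mulr0 mul0r.
move=> /(_ (Ideal cl)); apply => _ [a ->] /=.
rewrite mcoeff_of_path; case: eqP => // /(congr1 (@parr Q)) //.
Qed.

(* k C_(n+1) / J^(m+1); both indices are shifted because the cycle has at
   least one vertex and the exponent is at least one. *)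
Definition nakayama (k : fieldType) (n m : nat) :=
  quot_ring (ideal_pow (arrow_ideal k (cycle_quiver n)) m.+1).

Section Nakayama.
Variables (k : fieldType) (n m : nat).
Local Notation R := (nakayama k n m).

HB.instance Definition _ := GRing.PzRing.on R.
HB.instance Definition _ := GRing.Lmodule.on R.

Lemma nakayama_nz : (1 : R) != 0.
Proof.
apply/eqP => /qpiP; rewrite subr0 => /ideal_pow_sub.
move=> /(@arrow_ideal_coeff _ _ _ (ord0 : vertex (cycle_quiver n))) /eqP.
by rewrite mcoeff_pa_one oner_eq0.
Qed.

HB.instance Definition _ := GRing.PzSemiRing_isNonZero.Build R nakayama_nz.
HB.instance Definition _ :=
  GRing.Lmodule_isLalgebra.Build k R (@q_scaleAl k _ _).
HB.instance Definition _ :=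
  GRing.Lalgebra_isAlgebra.Build k R (@q_scaleAr k _ _).

End Nakayama.

Section DirectSum.
Variables (R : nzRingType) (I : finType) (M : I -> lmodType R).

Definition dsum := {dffun forall i, M i}.
HB.instance Definition _ := Choice.on dsum.
Implicit Types x y : dsum.

Definition ds_zero : dsum := [ffun i => 0].
Definition ds_opp x : dsum := [ffun i => - x i].
Definition ds_add x y : dsum := [ffun i => x i + y i].
Definition ds_scale (a : R) x : dsum := [ffun i => a *: x i].

Lemma ds_addA : associative ds_add.
Proof. by move=> x y z; apply/ffunP => i; rewrite !ffunE addrA. Qed.
Lemma ds_addC : commutative ds_add.
Proof. by move=> x y; apply/ffunP => i; rewrite !ffunE addrC. Qed.
Lemma ds_add0 : left_id ds_zero ds_add.
Proof. by move=> x; apply/ffunP => i; rewrite !ffunE add0r. Qed.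
Lemma ds_addN : left_inverse ds_zero ds_opp ds_add.
Proof. by move=> x; apply/ffunP => i; rewrite !ffunE addNr. Qed.
HB.instance Definition _ :=
  GRing.isZmodule.Build dsum ds_addA ds_addC ds_add0 ds_addN.

Lemma ds_scaleA a b x : ds_scale a (ds_scale b x) = ds_scale (a * b) x.
Proof. by apply/ffunP => i; rewrite !ffunE scalerA. Qed.
Lemma ds_scale1 : left_id 1 ds_scale.
Proof. by move=> x; apply/ffunP => i; rewrite !ffunE scale1r. Qed.
Lemma ds_scaleDr : right_distributive ds_scale +%R.
Proof. by move=> a x y; apply/ffunP => i; rewrite !ffunE scalerDr. Qed.
Lemma ds_scaleDl x : {morph ds_scale^~ x : a b / a + b}.
Proof. by move=> a b; apply/ffunP => i; rewrite !ffunE scalerDl. Qed.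
HB.instance Definition _ := GRing.Zmodule_isLmodule.Build R dsum
  ds_scaleA ds_scale1 ds_scaleDr ds_scaleDl.

End DirectSum.

Section Modules.
Variable R : nzRingType.
Implicit Types (M N U V X : lmodType R) (C : lmodType R -> Prop).

Definition mod_iso M N : Prop := exists f : {linear M -> N}, bijective f.

Definition fin_gen M : Prop :=
  exists (d : nat) (g : 'I_d -> M),
    forall x, exists a : 'I_d -> R, x = \sum_i a i *: g i.

Definition zero_mod M : Prop := forall x : M, x = 0.

Definition indecomposable M : Prop :=
  ~ zero_mod M /\
  forall U V, mod_iso M (U * V)%type -> zero_mod U \/ zero_mod V.

(* The empty family is allowed in [add_sum]. *)
Inductive add C : lmodType R -> Prop :=
| add_base M : C M -> add C M
| add_iso M N : mod_iso M N -> add C M -> add C N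
| add_sum (I : finType) (M : I -> lmodType R) :
    (forall i, add C (M i)) -> add C (dsum M)
| add_summand M N : add C (M * N)%type -> add C M.

(* [M] is (isomorphic to) a submodule of the free left module R^n. *)
Definition embeds_in_free M : Prop :=
  exists (n : nat) (f : {linear M -> 'rV[R]_n}), injective f.

Definition sub_class : lmodType R -> Prop :=
  add (fun U => fin_gen U /\ embeds_in_free U).

(* [X] is the direct sum of all indecomposable modules in the class [C], each
   isomorphism class being counted once. *)
Definition sum_of_indecomposables C X : Prop :=
  exists (I : finType) (M : I -> lmodType R),
  [/\ forall i, C (M i) /\ indecomposable (M i),
      forall i j, mod_iso (M i) (M j) -> i = j,
      forall N, C N -> indecomposable N -> exists i, mod_iso N (M i)
    & mod_iso X (dsum M)].

Definition is_AUS X : Prop := sum_of_indecomposables fin_gen X.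
Definition is_SUB X : Prop := sum_of_indecomposables sub_class X.

End Modules.

(* The product is the composition of maps; a scalar c acts through the central
   element c%:A of R. *)
Definition End_alg (k : fieldType) (R : algType k) (X : lmodType R) :=
  {linear X -> X}.

Section EndAlg.
Variables (k : fieldType) (R : algType k) (X : lmodType R).
Local Notation E := (End_alg X).
Implicit Types f g h : E.

HB.instance Definition _ := gen_eqMixin E.
HB.instance Definition _ := gen_choiceMixin E.

Lemma end_ext f g : f =1 g -> f = g.
Proof.
case: f g => [f [[Af] [Sf]]] [g [[Ag] [Sg]]] /= /funext fg.
case: _ / fg Ag Sg => Ag Sg.
by rewrite (Prop_irrelevance Af Ag) (Prop_irrelevance Sf Sg).
Qed.

Definition end_zero : E := @GRing.null_fun X X.
Definition end_opp f : E := \- f.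
Definition end_add f g : E := f \+ g.
Definition end_one : E := idfun.
Definition end_mul f g : E := f \o g.

Lemma end_addA : associative end_add.
Proof. by move=> f g h; apply: end_ext => x /=; rewrite addrA. Qed.
Lemma end_addC : commutative end_add.
Proof. by move=> f g; apply: end_ext => x /=; rewrite addrC. Qed.
Lemma end_add0 : left_id end_zero end_add.
Proof. by move=> f; apply: end_ext => x /=; rewrite add0r. Qed.
Lemma end_addN : left_inverse end_zero end_opp end_add.
Proof. by move=> f; apply: end_ext => x /=; rewrite addNr. Qed.
HB.instance Definition _ :=
  GRing.isZmodule.Build E end_addA end_addC end_add0 end_addN.

Lemma end_mulA : associative end_mul.
Proof. by move=> f g h; apply: end_ext. Qed.
Lemma end_mul1 : left_id end_one end_mul.
Proof. by move=> f; apply: end_ext. Qed.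
Lemma end_1mul : right_id end_one end_mul.
Proof. by move=> f; apply: end_ext. Qed.
Lemma end_mulDl : left_distributive end_mul +%R.
Proof. by move=> f g h; apply: end_ext. Qed.
Lemma end_mulDr : right_distributive end_mul +%R.
Proof. by move=> f g h; apply: end_ext => x /=; rewrite linearD. Qed.
HB.instance Definition _ := GRing.Zmodule_isPzRing.Build E
  end_mulA end_mul1 end_1mul end_mulDl end_mulDr.

Definition end_scale_fun (c : k) f (x : X) : X := c%:A *: f x.

Lemma end_scale_linear c f : linear (end_scale_fun c f).
Proof.
move=> a x y; rewrite /end_scale_fun linearP scalerDr !scalerA.
by rewrite mulr_algl mulr_algr.
Qed.
HB.instance Definition _ c f :=
  GRing.isLinear.Build R X X *:%R (end_scale_fun c f) (end_scale_linear c f).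

Definition end_scale (c : k) f : E := end_scale_fun c f.

Lemma end_scaleA a b f : end_scale a (end_scale b f) = end_scale (a * b) f.
Proof.
apply: end_ext => x; rewrite /= /end_scale_fun /= /end_scale_fun scalerA.
by rewrite mulr_algl scalerA.
Qed.
Lemma end_scale1 : left_id 1 end_scale.
Proof. by move=> f; apply: end_ext => x; rewrite /= /end_scale_fun !scale1r. Qed.
Lemma end_scaleDr : right_distributive end_scale +%R.
Proof. by move=> c f g; apply: end_ext => x; rewrite /= /end_scale_fun scalerDr. Qed.
Lemma end_scaleDl f : {morph end_scale^~ f : a b / a + b}.
Proof.
by move=> a b; apply: end_ext => x; rewrite /= /end_scale_fun !scalerDl.
Qed.
HB.instance Definition _ := GRing.Zmodule_isLmodule.Build k E
  end_scaleA end_scale1 end_scaleDr end_scaleDl.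

End EndAlg.

(* Isomorphism of k-algebras; [algType k] and [{lrmorphism _ -> _}] are not
   available for End_R(X), which is the zero ring when X = 0. *)
Definition End_iso (k : fieldType) (R : algType k) (X Y : lmodType R) : Prop :=
  exists phi : End_alg X -> End_alg Y,
    [/\ bijective phi, linear phi & monoid_morphism phi].

(* Main.v *)
(* It suffices to show that every finitely generated R-module M embeds in a
   free module: then sub(R) and all finitely generated modules have the same
   indecomposables, so AUS and SUB are isomorphic modules and conjugation
   identifies their endomorphism algebras.

   The embedding rests on R being a Frobenius algebra.  Its basis of paths of
   length at most m has a dual basis: to a path p of length l ending at v
   corresponds the path p' of length m - l starting at v.  As \sum p' (x) p is
   a Casimir element, every k-linear form f on M induces the R-linear map
   x |-> \sum_p f (p' x) p from M to R, which vanishes at x only if f vanishes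
   on R x.  Finitely many forms separate the points of M, so finitely many
   such maps embed M in a free module. *)
From HB Require Import structures.
Require Import Defs.
From mathcomp Require Import all_boot all_order all_algebra.
From mathcomp Require Import finmap monalg boolp.

Set Implicit Arguments.
Unset Strict Implicit.
Unset Printing Implicit Defensive.

Import GRing.Theory.
Local Open Scope ring_scope.

(** Choice with a varying codomain, as is needed to pick maps between the members of two families of
    modules. *)
Lemma dependent_choice_fun (X : Type) (Y : X -> Type)
    (P : forall x, Y x -> Prop) :
  (forall x, exists y, P x y) -> exists f : forall x, Y x, forall x, P x (f x).
Proof. by move=> xP; exists (fun x => projT1 (cid (xP x))) => x; case: cid. Qed.

(** * Isomorphisms and finite generation of direct sums *)

Section Isomorphisms.
Variable R : nzRingType.
Implicit Types M N X Y : lmodType R.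

Lemma mod_isoP M N : mod_iso M N <->
  exists (f : {linear M -> N}) (g : {linear N -> M}), cancel f g /\ cancel g f.
Proof.
split=> [[f [g fK gK]]|[f [g [fK gK]]]]; last by exists f; exists g.
pose gL := GRing.isLinear.Build R N M *:%R g (can2_linear fK gK).
pose g' : {linear N -> M} := HB.pack g gL.
by exists f, g'.
Qed.

Lemma mod_iso_sym M N : mod_iso M N -> mod_iso N M.
Proof. by move=> /mod_isoP[f [g [fK gK]]]; exists g; exists f. Qed.

Lemma mod_iso_trans M N X : mod_iso M N -> mod_iso N X -> mod_iso M X.
Proof. by move=> [f fb] [g gb]; exists (g \o f); apply: bij_comp. Qed.

Lemma dsum_mod_iso (I J : finType) (M : I -> lmodType R) (N : J -> lmodType R)
    (t : J -> I) :
  bijective t -> (forall j, mod_iso (M (t j)) (N j)) ->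
  mod_iso (dsum M) (dsum N).
Proof.
move=> /[dup] /bij_inj t_inj [s tK sK].
move=> MN.
have [f] := dependent_choice_fun (fun j => (mod_isoP _ _).1 (MN j)).
move=> /dependent_choice_fun[g fg].
pose h (x : dsum M) : dsum N := [ffun j => f j (x (t j))].
have h_lin : linear h.
  by move=> a x y; apply/ffunP => j; rewrite !ffunE linearP.
pose hL := GRing.isLinear.Build R (dsum M) (dsum N) *:%R h h_lin.
pose h' : {linear dsum M -> dsum N} := HB.pack h hL.
have h'E : h' = h :> (_ -> _) by [].
exists h'; rewrite h'E.
(* A preimage needs a component in [M i], while [g] lands in [M (t j)]. Quantifying over
   [e : i = t j] makes the transport explicit; with [i] written as [t (s i)], injectivity of [t]
   reduces it to the identity. *)
have preim (y : dsum N) :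
    forall i, exists z : M i,
      forall j (e : i = t j), f j (ecast i (M i) e z) = y j.
  move=> i; rewrite -(sK i); exists (g (s i) (y (s i))) => j e.
  have ej := t_inj _ _ e; case: j / ej e => e.
  by rewrite (Prop_irrelevance e erefl) /= (fg _).2.
have /choice[h1 h1E] : forall y : dsum N, exists x : dsum M, h x = y.
  move=> y; have [z zE] := dependent_choice_fun (preim y).
  exists [ffun i => z i]; apply/ffunP => j; rewrite !ffunE.
  by rewrite -(zE _ j erefl).
exists h1 => // x; apply/ffunP => i; rewrite -(sK i).
by have /ffunP/(_ (s i)) := h1E (h x); rewrite !ffunE => /(can_inj (fg _).1).
Qed.

Lemma fin_gen_finType M (J : finType) (g : J -> M) :
  (forall x, exists a : J -> R, x = \sum_j a j *: g j) -> fin_gen M.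
Proof.
move=> gP; exists #|J|, (fun i => g (enum_val i)) => x.
have [a ->] := gP x; exists (fun i => a (enum_val i)).
by rewrite (reindex_onto enum_val enum_rank) => [|j _];
  [apply: eq_bigl => i; rewrite enum_valK eqxx | rewrite enum_rankK].
Qed.

Lemma fin_gen_surj M N (f : {linear M -> N}) :
  (forall y, exists x, f x = y) -> fin_gen M -> fin_gen N.
Proof.
move=> f_surj [d [g gP]]; exists d, (f \o g) => y.
have [x <-] := f_surj y; have [a ->] := gP x; exists a.
by rewrite linear_sum; apply: eq_bigr => i _; rewrite linearZ.
Qed.

Lemma fin_gen_dsum (I : finType) (M : I -> lmodType R) :
  (forall i, fin_gen (M i)) -> fin_gen (dsum M).
Proof.
move=> /dependent_choice_fun[d] /dependent_choice_fun[g gP].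
(* The canonical injection of the summand [i]; the equality test supplies the proof along which [z]
   is transported. *)
pose inj i (z : M i) : dsum M :=
  [ffun j => if i =P j is ReflectT e then ecast j (M j) e z else 0].
have injE i z : inj i z i = z.
  by rewrite ffunE; case: eqP => // e; rewrite (Prop_irrelevance e erefl).
have injN i j z : i != j -> inj i z j = 0.
  by rewrite ffunE; case: eqP.
apply: (@fin_gen_finType _ {i : I & 'I_(d i)}
  (fun j => inj _ (g _ (tagged j)))) => x.
have /dependent_choice_fun[a aP] i := gP i (x i).
exists (fun j => a _ (tagged j)).
rewrite -(sig_big_dep (fun _ => true) (fun _ _ => true)
  (fun i j => a i j *: inj i (g i j))) /=.
apply/ffunP => i.
have sumE (T : finType) (F : T -> dsum M) : (\sum_t F t) i = \sum_t F t i.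
  by apply: (big_morph (fun y : dsum M => y i)) => [y z|]; rewrite ffunE.
rewrite [RHS]sumE (bigD1 i) //= [X in _ + X]big1 ?addr0 => [|j ji].
  by rewrite [RHS]sumE aP; apply: eq_bigr => j _; rewrite ffunE injE.
by rewrite [LHS]sumE big1 // => l _; rewrite ffunE injN ?scaler0.
Qed.

Lemma add_fin_gen (C : lmodType R -> Prop) M :
  (forall N, C N -> fin_gen N) -> Defs.add C M -> fin_gen M.
Proof.
move=> Cfg; elim=> {M} [M /Cfg //|M N [f [g _ gK]] _|I M _|M N _].
- by apply: (fin_gen_surj (f := f)) => y; exists (g y).
- exact: fin_gen_dsum.
- by apply: (fin_gen_surj (f := fst)) => x; exists (x, 0).
Qed.

(** Each summand on one side is isomorphic to one on the other; as no isomorphism class is repeated,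
    the two matchings of indices are mutually inverse. *)
Lemma sum_of_indecomposables_iso (C D : lmodType R -> Prop) X Y :
  (forall M, indecomposable M -> C M <-> D M) ->
  sum_of_indecomposables C X -> sum_of_indecomposables D Y -> mod_iso X Y.
Proof.
move=> CD [I [M [Mi Minj Mall XM]]] [J [N [Ni Ninj Nall YN]]].
apply: mod_iso_trans XM _; apply: mod_iso_trans (mod_iso_sym YN).
have /choice[t tP] j : exists i, mod_iso (N j) (M i).
  by have [Dj ij] := Ni j; apply: Mall => //; apply/CD.
have /choice[s sP] i : exists j, mod_iso (M i) (N j).
  by have [Ci ii] := Mi i; apply: Nall => //; apply/CD.
apply: (@dsum_mod_iso _ _ _ _ t) => [|j]; last exact: mod_iso_sym.
exists s => [j|i]; apply/esym.
  by apply: Ninj; apply: mod_iso_trans (tP j) (sP _).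
by apply: Minj; apply: mod_iso_trans (sP i) (tP _).
Qed.

End Isomorphisms.

Lemma mod_iso_End_iso (k : fieldType) (R : algType k) (X Y : lmodType R) :
  mod_iso X Y -> End_iso X Y.
Proof.
move=> /mod_isoP[f [g [fK gK]]].
pose conj (u : End_alg X) : End_alg Y := f \o u \o g.
exists conj; split.
- exists (fun v : End_alg Y => g \o v \o f : End_alg X) => u;
    by apply: end_ext => x /=; rewrite ?fK ?gK.
- move=> c u v; apply: end_ext => x.
  by rewrite /= /end_scale_fun /= linearD linearZ.
- by split=> [|u v]; apply: end_ext => x /=; rewrite ?gK ?fK.
Qed.

(** * Embedding modules by means of k-linear forms and a Casimir element *)

Section FrobeniusEmbedding.
Variables (k : fieldType) (R : algType k).
Implicit Types M : lmodType R.

(** Only the [R]-module structure of [M] is given, so scalars of [k] act through [c%:A]. *)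
Definition k_spanned_by M d (g : 'I_d -> M) : Prop :=
  forall x, exists a : 'I_d -> k, x = \sum_i (a i)%:A *: g i.

Definition k_form M (f : M -> k) : Prop :=
  forall c x y, f (c%:A *: x + y) = c * f x + f y.

Lemma scaler_algA M (a b : k) (x : M) : (a * b)%:A *: x = a%:A *: (b%:A *: x).
Proof. by rewrite scalerA mulr_algl scalerA. Qed.

Lemma minimal_k_spanning M d0 (g0 : 'I_d0 -> M) :
  k_spanned_by g0 -> exists d (g : 'I_d -> M), k_spanned_by g /\
    forall a : 'I_d -> k, \sum_i (a i)%:A *: g i = 0 -> forall i, a i = 0.
Proof.
move=> g0P; pose P d := `[< exists g : 'I_d -> M, k_spanned_by g >].
have exP : exists d, P d by exists d0; apply/asboolP; exists g0.
case: (ex_minnP exP) => d /asboolP[g gP] dmin; exists d, g; split=> // a ag j.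
apply: contrapT => /eqP aj.
case: d => [|d] in g gP dmin a ag j aj *; first by case: j {aj}.
suff /dmin : P d by rewrite ltnn.
apply/asboolP; exists (g \o lift j) => x; have [b ->] := gP x.
(* Subtracting [b j / a j] times the relation from the expansion of [x] cancels the term of [g j],
   against minimality of [d]. *)
exists (fun i => b (lift j i) - b j / a j * a (lift j i)).
transitivity (\sum_i (b i)%:A *: g i -
              (b j / a j)%:A *: (\sum_i (a i)%:A *: g i)).
  by rewrite ag scaler0 subr0.
rewrite scaler_sumr -sumrB (bigD1_ord j) //= -scaler_algA divfK //.
rewrite subrr add0r; apply: eq_bigr => i _ /=.
by rewrite -scaler_algA -scalerBl -[in LHS]scalerBl.
Qed.

(** The forms are the coordinates in a basis. They are obtained by choice; their linearity follows
    from the uniqueness of expansions. *)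
Lemma separating_k_forms M d0 (g0 : 'I_d0 -> M) :
  k_spanned_by g0 -> exists d (f : 'I_d -> M -> k),
    (forall i, k_form (f i)) /\ forall x, (forall i, f i x = 0) -> x = 0.
Proof.
move=> /minimal_k_spanning[d [g [/choice[a aE] g_free]]].
exists d, (fun i x => a x i); split=> [i c x y|x ax0]; last first.
  by rewrite (aE x) big1 // => i _; rewrite ax0 scale0r scale0r.
apply/eqP; rewrite -subr_eq0; apply/eqP.
apply: (g_free (fun i => a (c%:A *: x + y) i - (c * a x i + a y i))).
under eq_bigr => j _ do rewrite !(scalerBl, scalerDl) scaler_algA.
by rewrite sumrB big_split /= -scaler_sumr -!aE subrr.
Qed.

Variables (J : finType) (b b' : J -> R).

Lemma fin_gen_k_spanned M :
  (forall r, exists a : J -> k, r = \sum_j a j *: b j) ->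
  fin_gen M -> exists d (g : 'I_d -> M), k_spanned_by g.
Proof.
move=> /choice[a aE] [d [g gP]].
pose T := ('I_d * J)%type.
exists #|{: T}|, (fun t => b (enum_val t).2 *: g (enum_val t).1) => x.
have [r ->] := gP x; exists (fun t => a (r (enum_val t).1) (enum_val t).2).
pose F (p : T) := (a (r p.1) p.2)%:A *: (b p.2 *: g p.1).
rewrite -[RHS](big_enum_val (fun p : T => F p)) /=.
rewrite -(pair_bigA _ (fun i j => F (i, j))) /=; apply: eq_bigr => i _.
rewrite {1}(aE (r i)) scaler_suml; apply: eq_bigr => j _.
by rewrite /F /= scalerA mulr_algl.
Qed.

(* The third hypothesis says that the element [\sum_j b' j (x) b j] of the
   tensor product over k commutes with R, i.e. that it is a Casimir element. *)
Lemma fin_gen_embeds_in_free M :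
  (forall r, exists a : J -> k, r = \sum_j a j *: b j) ->
  (forall a : J -> k, \sum_j a j *: b j = 0 -> forall j, a j = 0) ->
  (forall (f : R -> k) r, scalar f ->
     \sum_j f (b' j * r) *: b j = r * \sum_j f (b' j) *: b j) ->
  (exists u : J -> R, 1 = \sum_j u j * b' j) ->
  fin_gen M -> embeds_in_free M.
Proof.
move=> b_span b_free casimir [u u1] M_fg.
have [d0 [g0 /separating_k_forms[d [f [f_form f_sep]]]]] :=
  fin_gen_k_spanned b_span M_fg.
pose F i x := \sum_j f i (b' j *: x) *: b j.
have F_lin i : linear_for *%R (F i).
  move=> r x y; rewrite /F.
  have fx : scalar (fun s => f i (s *: x)).
    by move=> c s t; rewrite scalerDl -mulr_algl -scalerA f_form.
  have fD s t : f i (s + t) = f i s + f i t.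
    by have := f_form i 1 s t; rewrite !scale1r mul1r.
  (* The Casimir identity, applied to the form [s |-> f i (s *: x)] on [R], moves [r] out of the
     sum. *)
  rewrite -(casimir _ r fx) -big_split; apply: eq_bigr => j _ /=.
  by rewrite -scalerDl scalerDr fD scalerA.
pose h (x : M) : 'rV[R]_d := \row_i F i x.
have h_lin : linear h.
  by move=> r x y; apply/rowP => i; rewrite !mxE F_lin.
pose hL := GRing.isLinear.Build R M 'rV[R]_d *:%R h h_lin.
pose h' : {linear M -> 'rV[R]_d} := HB.pack h hL.
exists d, h'; apply: raddf_inj => x /rowP hx0.
(* Now [x] is a combination of the [b' j *: x]. Freeness of [b] turns [F i x = 0] into
   [f i (b' j *: x) = 0] for all [i] and [j], and the forms separate points. *)
rewrite -[x]scale1r u1 scaler_suml big1 // => j _; rewrite -scalerA.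
suff -> : b' j *: x = 0 by rewrite scaler0.
apply: f_sep => i; move: j; apply: b_free.
by have := hx0 i; rewrite !mxE.
Qed.

End FrobeniusEmbedding.

(** This index shift is what multiplication by an arrow amounts to in the Casimir identity. *)
Lemma sum_ord_shift (V : nmodType) d (F : nat -> V) :
  F 0%N = 0 -> F d.+1 = 0 -> \sum_(i < d.+1) F i = \sum_(i < d.+1) F i.+1.
Proof.
by move=> F0 Fd; rewrite big_ord_recl big_ord_recr /= F0 Fd add0r addr0.
Qed.

(** * Path lengths and generators in a path algebra *)

Section LongPaths.
Variables (k : fieldType) (Q : quiver).
Local Notation A := (path_algebra k Q).

Definition long_paths_only (d : nat) (x : A) : Prop :=
  forall p, (size (parr p) < d)%N -> x@_p = 0.

Lemma long_paths_onlyM c d x y :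
  long_paths_only c x -> long_paths_only d y -> long_paths_only (c + d) (x * y).
Proof.
move=> xc yd p p_lt; rewrite -[x * y]/(pa_mul x y) pa_mul.unlock.
rewrite raddf_sum big1 // => q _; rewrite raddf_sum big1 // => r _.
rewrite /= mcoeffZ; case: pcompP => [s _ _ _ sE|_] /=; last first.
  by rewrite mcoeff0 mulr0.
rewrite mcoeff_of_path; case: eqP => [sp|]; last by rewrite mulr0.
move: p_lt; rewrite -sp sE size_cat addnC => p_lt.
have [q_lt|q_ge] := ltnP (size (parr q)) c; first by rewrite xc // !mul0r.
by rewrite yd ?mulr0 ?mul0r // -(ltn_add2l c) (leq_ltn_trans _ p_lt) // leq_add2r.
Qed.

Lemma long_paths_only_ideal d : ideal_closed (long_paths_only d).
Proof.
split=> [p _|x y xd yd p p_lt|a x b xd]; first exact: mcoeff0.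
  by rewrite mcoeffD xd // yd // addr0.
rewrite -[d]addn0; apply: long_paths_onlyM; last by [].
by rewrite -[d]add0n; apply: long_paths_onlyM.
Qed.

(** Lengths add under composition and arrows have length 1. This bound is what keeps short paths
    independent modulo a power of the arrow ideal. *)
Lemma arrow_ideal_pow_long d (x : A) :
  ideal_pow (arrow_ideal k Q) d x -> long_paths_only d x.
Proof.
elim: d x => [|d IHd] x //.
(* With the goal read as membership in an ideal, it suffices to check the generating products. *)
apply: (_ : ideal_pow _ d.+1 x -> Ideal (long_paths_only_ideal d.+1) x).
apply=> _ [y [z [yJ zJ ->]]]; rewrite -add1n.
apply: long_paths_onlyM (IHd _ zJ).
apply: (yJ (Ideal (long_paths_only_ideal 1))) => _ [a ->] p p0.
by rewrite mcoeff_of_path; case: eqP p0 => // <-.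
Qed.

(** Vertices and arrows generate the algebra, since a nontrivial path is its tail composed after its
    first arrow. *)
Lemma path_algebra_ind (P : A -> Prop) :
  (forall x y, P x -> P y -> P (x + y)) ->
  (forall x y, P x -> P y -> P (x * y)) ->
  (forall (c : k) x, P x -> P (c *: x)) ->
  (forall v, P (of_path k (vpath v))) ->
  (forall a, P (of_path k (apath a))) ->
  forall x, P x.
Proof.
move=> PD PM PZ Pv Pa.
have P0 : P 0.
  have /card_gt0P[v _] := quiver_neq0 Q.
  by rewrite -(scale0r (of_path k (vpath v))); apply: PZ.
suff Pp p : P (of_path k p).
  by move=> x; rewrite (of_pathE x); apply: big_ind => // p _; apply: PZ.
move: {2}(parr p) (erefl (parr p)) => s; elim: s p => [|a s IHs] p pE.
  suff -> : p = vpath (psrc p) by apply: Pv.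
  by apply: qpath_inj => //; move: (parrP p); rewrite pE => /eqP.
have := parrP p; rewrite pE /= => /andP[/eqP ap sp].
pose q : qpath Q := @QPath Q (tgt a, s, ptgt p) sp.
suff -> : of_path k p = of_path k q * of_path k (apath a)
  by apply: PM; [apply: (IHs q)|apply: Pa].
rewrite -[RHS]/(pa_mul _ _) pa_mulUU.
case: pcompP => [r _ r1 r2 r3|/(_ erefl) //] /=; congr of_path.
by apply: qpath_inj; rewrite ?r1 ?r2 ?r3 ?pE.
Qed.

End LongPaths.

(** * Paths in the oriented cycle *)

Section NakayamaBasis.
Variables (k : fieldType) (n m : nat).
Local Notation Q := (cycle_quiver n).
Local Notation A := (path_algebra k Q).
Local Notation R := (nakayama k n m).
Local Notation J := (arrow_ideal k Q).
Implicit Types v w : 'I_n.+1.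

Let e v : A := of_path k (@vpath Q v).
Let ar v : A := of_path k (@apath Q v).

(** On the cycle a path is determined by its length and either endpoint. [path_to] peels off the
    last arrow and suits multiplication on the left; [path_from] peels off the first and suits
    multiplication on the right. *)
Fixpoint path_to (w : 'I_n.+1) (l : nat) : A :=
  if l is l'.+1 then ar (ord_pred w) * path_to (ord_pred w) l' else e w.

Fixpoint path_from (v : 'I_n.+1) (l : nat) : A :=
  if l is l'.+1 then path_from (ordS v) l' * ar v else e v.

Lemma path_toP w l : exists p : qpath Q,
  [/\ path_to w l = of_path k p, ptgt p = w & size (parr p) = l].
Proof.
elim: l w => [|l IHl] w /=; first by exists (@vpath Q w).
have [p [-> pw <-]] := IHl (ord_pred w).
rewrite -[ar _ * _]/(pa_mul _ _) pa_mulUU.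
case: pcompP => [r r0 r1 r2 r3|/=]; last by rewrite pw.
exists r; split=> //; first by rewrite r2 /ptgt /= ord_predK.
by rewrite r3 size_cat addn1.
Qed.

Lemma vertexM v w l : e v * path_to w l = if v == w then path_to w l else 0.
Proof.
have [p [-> <- _]] := path_toP w l.
by rewrite -[LHS]/(pa_mul _ _) pa_mulUU pcomp1p; case: (v == _).
Qed.

Lemma arrowM v w l :
  ar v * path_to w l = if v == w then path_to (ordS v) l.+1 else 0.
Proof.
case: eqP => [<-|vw]; first by rewrite /= ordSK.
have [p [-> pw _]] := path_toP w l.
rewrite -[LHS]/(pa_mul _ _) pa_mulUU; case: pcompP => // r.
by rewrite pw => /esym.
Qed.

Lemma path_fromS v l : path_from v l = path_to (iter l (@ordS _) v) l.
Proof.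
elim: l v => [|l IHl] v //; rewrite [LHS]/= IHl -iterSr.
elim: l {IHl} => [|l IHl] /=.
  rewrite ordSK -[LHS]/(pa_mul _ _) -[RHS]/(pa_mul _ _) !pa_mulUU.
  by rewrite pcomp1p pcompp1 !eqxx.
by rewrite ordSK -mulrA IHl /= ordSK.
Qed.

Lemma path_fromM v l w :
  path_from v l * e w = if v == w then path_from v l else 0.
Proof.
case: l => [|l] /=.
  rewrite -[LHS]/(pa_mul _ _) pa_mulUU pcomp1p -[ptgt _]/w.
  by case: eqP => [->|].
rewrite -mulrA -[ar v * e w]/(pa_mul _ _) pa_mulUU pcompp1 -[psrc _]/v eq_sym.
by case: eqP => [->//|] /=; rewrite mulr0.
Qed.

Lemma path_fromMa v l w :
  path_from v l * ar w = if v == ordS w then path_from w l.+1 else 0.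
Proof.
case: eqP => [->//|vw]; case: l => [|l] /=.
  by rewrite -[LHS]/(pa_mul _ _) pa_mulUU pcomp1p; case: eqP vw.
rewrite -mulrA -[ar v * ar w]/(pa_mul _ _) pa_mulUU.
case: pcompP => [r /esym //|_] /=.
by rewrite mulr0.
Qed.

Lemma path_to_pow w l : ideal_pow J l (path_to w l).
Proof.
elim: l w => [|l IHl] w //= I; apply.
exists (ar (ord_pred w)), (path_to (ord_pred w) l); split=> //.
by move=> I' ; apply; exists (ord_pred w).
Qed.

(** * Dual bases of the Nakayama algebra *)

Let pi (x : A) : R := @qpi _ (ideal_pow J m.+1) x.

Lemma piD x y : pi (x + y) = pi x + pi y. Proof. exact: qpiD. Qed.
Lemma piM x y : pi (x * y) = pi x * pi y. Proof. exact: qpiM. Qed.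
Lemma piZ (c : k) x : pi (c *: x) = c *: pi x. Proof. exact: qpiZ. Qed.
Lemma pi0 : pi 0 = 0. Proof. by []. Qed.
Lemma pi_sum (I : finType) (F : I -> A) : pi (\sum_i F i) = \sum_i pi (F i).
Proof. exact: (big_morph pi piD pi0). Qed.

Lemma pi_eq0 x : pi x = 0 <-> ideal_pow J m.+1 x.
Proof. by rewrite -[ideal_pow J _ x]/(_ x) -{2}[x]subr0; apply: qpiP. Qed.

Lemma pi_path_to w : pi (path_to w m.+1) = 0.
Proof. exact/pi_eq0/path_to_pow. Qed.

Lemma pi_path_from v : pi (path_from v m.+1) = 0.
Proof. by rewrite path_fromS pi_path_to. Qed.

Local Notation T := ('I_n.+1 * 'I_m.+1)%type.

Definition nak_basis (t : T) : R := pi (path_to t.1 t.2).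
(** [nak_dual t * nak_basis t] is a path of length [m], the greatest length surviving in [R]. The
    subtraction is exact because [t.2] is at most [m]. *)
Definition nak_dual (t : T) : R := pi (path_from t.1 (m - t.2)).

(** A relation lifts to an element of the ideal power, whose coefficients at paths of length at most
    [m] vanish. *)
Lemma nak_basis_free (a : T -> k) :
  \sum_t a t *: nak_basis t = 0 -> forall t, a t = 0.
Proof.
move=> a0 t; have : pi (\sum_t a t *: path_to t.1 t.2) = 0.
  by rewrite pi_sum -[RHS]a0; apply: eq_bigr => j _; rewrite piZ.
move=> /pi_eq0/arrow_ideal_pow_long.
have [p [tp p1 p2]] := path_toP t.1 t.2.
move=> /(_ p); rewrite p2 => /(_ (ltn_ord _)).
rewrite raddf_sum (bigD1 t) //= big1 => [|t' t't].
  by rewrite mcoeffZ tp mcoeff_of_path eqxx mulr1 addr0.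
have [q [-> q1 q2]] := path_toP t'.1 t'.2.
rewrite mcoeffZ mcoeff_of_path; case: eqP => [qp|]; last by rewrite mulr0.
case/eqP: t't; case: t t' {a0 tp} p1 p2 q1 q2 => [? ?] [? ?] /=.
by rewrite qp => -> lp -> lq; congr pair; apply: val_inj; rewrite /= -lp -lq.
Qed.

(* The duals of the paths of length m are the vertices. *)
Lemma sum_dual_vertices :
  1 = \sum_t pi (if t.2 == ord_max :> 'I_m.+1 then 1 else 0) * nak_dual t.
Proof.
rewrite -(pair_bigA _ (fun v (l : 'I_m.+1) =>
  pi (if l == ord_max then 1 else 0) * nak_dual (v, l))) /=.
transitivity (pi (\sum_v e v)) => //.
rewrite pi_sum; apply: eq_bigr => v _.
rewrite (bigD1 ord_max) //= eqxx big1 => [|l /negPf->].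
  by rewrite addr0 -piM mul1r /nak_dual /= subnn.
by rewrite -piM mul0r pi0.
Qed.

(** The span contains 1 and is stable under left multiplication by vertices and arrows, hence by all
    of [R]. *)
Lemma nak_basis_span (r : R) :
  exists a : T -> k, r = \sum_t a t *: nak_basis t.
Proof.
pose S (r : R) := exists a : T -> k, r = \sum_t a t *: nak_basis t.
have SD x y : S x -> S y -> S (x + y).
  move=> [a ->] [b ->]; exists (fun t => a t + b t).
  by rewrite -big_split; apply: eq_bigr => t _; rewrite /= scalerDl.
have SZ c x : S x -> S (c *: x).
  move=> [a ->]; exists (fun t => c * a t).
  by rewrite scaler_sumr; apply: eq_bigr => t _; rewrite scalerA.
have S0 : S 0 by exists (fun _ => 0); rewrite big1 // => t _; rewrite scale0r.
have Sb w l : S (pi (path_to w l)).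
  have [lm|] := ltnP l m.+1.
    exists (fun t => (t == (w, Ordinal lm))%:R).
    rewrite (bigD1 (w, Ordinal lm)) //= eqxx scale1r big1 ?addr0 // => t.
    by move=> /negPf->; rewrite scale0r.
  move=> ml; have -> : pi (path_to w l) = 0; last exact: S0.
  elim: l w ml => // l IHl w; rewrite leq_eqVlt => /predU1P[[<-]|ml].
    exact: pi_path_to.
  by rewrite /= piM IHl ?mulr0.
have SM (x : A) : forall y, S y -> S (pi x * y).
  have Sgen (z : R) :
      (forall t, S (z * nak_basis t)) -> forall y, S y -> S (z * y).
    move=> zb y [a ->]; rewrite mulr_sumr; apply: (big_ind S) => // t _.
    by rewrite -scalerAr; apply: SZ.
  elim/path_algebra_ind: x => [x y Sx Sy|x y Sx Sy|c x Sx|v|a].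
  - by move=> z Sz; rewrite piD mulrDl; apply: SD; [apply: Sx|apply: Sy].
  - by move=> z Sz; rewrite piM -mulrA; apply/Sx/Sy.
  - by move=> z Sz; rewrite piZ -scalerAl; apply/SZ/Sx.
  - apply: Sgen => t; rewrite -piM (vertexM v); case: ifP => _ //; exact: Sb.
  - apply: Sgen => t; rewrite -piM (arrowM a); case: ifP => _ //; exact: Sb.
have S1 : S 1.
  rewrite sum_dual_vertices; apply: (big_ind S) => // t _.
  by rewrite -piM path_fromS; case: eqP => _; rewrite ?mul1r ?mul0r //; exact: Sb.
by elim/qpi_ind: r => x; rewrite -[ex _]/(S (pi x)) -[pi x]mulr1; apply: SM.
Qed.

(** The elements [r] satisfying this for every form are closed under sums, products and scalars, so
    vertices and arrows suffice. *)
Lemma nak_casimir (f : R -> k) (r : R) : scalar f ->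
  \sum_t f (nak_dual t * r) *: nak_basis t =
  r * \sum_t f (nak_dual t) *: nak_basis t.
Proof.
pose C (g : R -> k) s := \sum_t g (nak_dual t * s) *: nak_basis t.
pose fL (g : R -> k) := forall c x y, g (c *: x + y) = c * g x + g y.
suff C1 : fL f -> C f r = r * C f 1.
  move=> /C1 Cr; apply: (etrans Cr); apply: congr1.
  by apply: eq_bigr => t _; rewrite [X in f X]mulr1.
have fD g : fL g -> forall x y, g (x + y) = g x + g y.
  by move=> gL x y; have := gL 1 x y; rewrite scale1r mul1r.
have f0 g : fL g -> g 0 = 0.
  by move=> gL; have := fD _ gL 0 0; rewrite addr0 -[LHS]addr0 => /addrI/esym.
have fZ g : fL g -> forall c x, g (c *: x) = c * g x.
  by move=> gL c x; have := gL c x 0; rewrite !addr0 f0 // addr0.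
elim/qpi_ind: r => x; rewrite -/(pi x).
(* The form must vary: the case of a product [x * y] uses the hypothesis on [x] for the form
   [s |-> f (s * pi y)]. *)
move: f; elim/path_algebra_ind: x
  => [x y Hx Hy|x y Hx Hy|c x Hx|v|a] f fl.
- rewrite piD mulrDl -Hx // -Hy // /C -big_split; apply: eq_bigr => t _ /=.
  by rewrite mulrDr fD // scalerDl.
- have gl : fL (fun s => f (s * pi y)).
    by move=> c s t; rewrite mulrDl -scalerAl fl.
  transitivity (C (fun s => f (s * pi y)) (pi x)).
    by apply: eq_bigr => t _; rewrite piM mulrA.
  apply: (etrans (Hx _ gl)); rewrite piM -[RHS]mulrA; apply: congr1.
  apply: etrans (Hy _ fl).
  by apply: eq_bigr => t _; rewrite [X in X * pi y]mulr1.
- rewrite piZ -scalerAl -Hx // scaler_sumr; apply: eq_bigr => t _.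
  apply: etrans (esym (scalerA _ _ _)).
  apply: (congr1 (fun z => z *: nak_basis t)).
  apply: etrans (fZ _ fl _ _); apply: congr1.
  exact/esym/scalerAr.
- rewrite mulr_sumr; apply: eq_bigr => t _; rewrite mulr1 -scalerAr.
  rewrite /nak_dual /nak_basis -!piM vertexM path_fromM eq_sym.
  case: ifP => _; first by [].
  by rewrite pi0 (f0 _ fl) scale0r scaler0.
rewrite mulr_sumr /C.
have pairE (F : T -> R) : \sum_t F t = \sum_w \sum_l F (w, l).
  by rewrite pair_bigA; apply: eq_bigr => [[]].
(* For an arrow [a], only the pairs at the target of [a] survive on the left, and only those at its
   source on the right. *)
rewrite !pairE (bigD1 (ordS a)) //= [X in _ + X]big1 => [|w wa]; last first.
  apply: big1 => l _; rewrite /nak_dual -piM path_fromMa (negPf wa).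
  by rewrite pi0 (f0 _ fl) scale0r.
rewrite [RHS](bigD1 a) //= [X in _ = _ + X]big1 => [|w wa]; last first.
  apply: big1 => l _; rewrite mulr1 -scalerAr /nak_basis -piM arrowM eq_sym (negPf wa).
  by rewrite pi0 scaler0.
(* The left side sums [G l] and the right side [G l.+1], for [l] from 0 to [m]. The unmatched terms
   [G 0] and [G m.+1] each involve a path of length [m.+1], which is zero in [R]. *)
pose G l := f (pi (path_from a (m.+1 - l))) *: pi (path_to (ordS a) l).
have lhsE (l : 'I_m.+1) :
    f (nak_dual (ordS a, l) * pi (ar a)) *: nak_basis (ordS a, l) = G l.
  by rewrite /nak_dual -piM path_fromMa eqxx /G subSn // -ltnS.
have rhsE (l : 'I_m.+1) :
    pi (ar a) * (f (nak_dual (a, l) * 1) *: nak_basis (a, l)) = G l.+1.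
  by rewrite mulr1 -scalerAr /nak_basis -piM arrowM eqxx.
rewrite !addr0 (eq_bigr _ (fun l _ => lhsE l)).
apply: etrans (esym (eq_bigr _ (fun l _ => rhsE l))).
apply: sum_ord_shift; rewrite /G; last by rewrite pi_path_to scaler0.
by rewrite subn0 pi_path_from (f0 _ fl) scale0r.
Qed.

Lemma nakayama_embeds_in_free (M : lmodType R) : fin_gen M -> embeds_in_free M.
Proof.
apply: (fin_gen_embeds_in_free nak_basis_span nak_basis_free nak_casimir).
by eexists; apply: sum_dual_vertices.
Qed.

End NakayamaBasis.

Theorem corollary6p19 (k : closedFieldType) (n m : nat)
    (AUS SUB : lmodType (nakayama k n m)) :
  is_AUS AUS -> is_SUB SUB -> End_iso AUS SUB.
Proof.
move=> ausP subP; apply/mod_iso_End_iso.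
(* The two classes agree: one inclusion is the embedding, the other holds because [add] preserves
   finite generation. *)
apply: sum_of_indecomposables_iso ausP subP => M _; split=> [M_fg|].
  by apply: add_base; split=> //; apply: nakayama_embeds_in_free.
by apply: add_fin_gen => N [].
Qed.
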